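(* For $\beta>0$ let $a_\beta,\mu_\beta,R_\beta\in(0,\infty)$ be the parameters of the spherically symmetric decreasing minimizer of $\mathcal{F}_\beta(\phi)=\frac12\|\nabla\phi\|_2^2+\beta\|\phi\|_1$ under the constraint $\|\phi\|_2=1$ (as described in the context), and let $F_\beta$ be the minimal value of $\mathcal{F}_\beta$ under this constraint. Then there exist constants $a_1,\mu_1,R_1\in(0,\infty)$ such that for any $\beta>0$ $$a_\beta=\beta^{3/7}a_1,\qquad \mu_\beta=\beta^{2/7}\mu_1,\qquad R_\beta=\beta^{-2/7}R_1.$$ Moreover, there is a constant $F_1\in(0,\infty)$ such that $F_\beta=\beta^{4/7}F_1$ for any $\beta>0$.
   Context: $\|\cdot\|_p$ denotes the $L^p(\mathbb{R}^3)$ norm, and $\mathcal{F}_\beta$ is defined on $H^1(\mathbb{R}^3)\cap L^1(\mathbb{R}^3)$, where $H^1=W^{1,2}$; functions are real-valued. $\phi^*$ denotes the spherically symmetric decreasing rearrangement of $|\phi|$. The paper establishes separately that for each $\beta>0$ there is a unique minimizer $\phi_\beta$ of $\mathcal{F}_\beta$ over $\{\phi\in H^1(\mathbb{R}^3)\cap L^1(\mathbb{R}^3):\|\phi\|_2=1\}$ satisfying $\phi_\beta=\phi_\beta^*$, and that its radial profile is $$\phi_\beta(r)=a_\beta\frac{\sin(\mu_\beta r)}{\mu_\beta r}+\frac{\beta}{\mu_\beta^2}\ \text{ for } r\le R_\beta,\qquad \phi_\beta(r)=0\ \text{ for } r>R_\beta,$$ where $a_\beta,\mu_\beta,R_\beta\in(0,\infty)$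 are uniquely determined by $R_\beta=\min\{r>0\mid\phi_\beta(r)=0\}$, $\phi_\beta'(R_\beta)=0$ and $\|\phi_\beta\|_2=1$. Also $F_\beta=\inf\{\mathcal{F}_\beta(\phi):\phi\in H^1(\mathbb{R}^3)\cap L^1(\mathbb{R}^3),\ \|\phi\|_2=1\}$. *)

(* Defs.v *)
From HB Require Import structures.
From mathcomp Require Export all_boot all_order all_algebra.
From mathcomp Require Export all_classical all_reals all_analysis.
From mathcomp Require Export measurable_realfun.
Export Order.TTheory GRing.Theory Num.Theory.
Export numFieldNormedType.Exports.

Set Implicit Arguments.
Unset Strict Implicit.
Unset Printing Implicit Defensive.

Local Open Scope classical_set_scope.
Local Open Scope ring_scope.

(* [R * R * R] carries the product (max-norm) topology and the product Borel
   sigma-algebra.  The max norm is used only through the topology and for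
   directional derivatives; Euclidean lengths are [enorm] below. *)
Notation R3 R := (measurableTypeR R * measurableTypeR R * measurableTypeR R)%type.

(* Registered by hand for [leb2] and [leb3] below: the library's sigma-finite
   instance for products is hidden by its instance for probability measures. *)
Lemma product_measure_sigma_finite (d1 d2 : measure_display)
    (T1 : measurableType d1) (T2 : measurableType d2) (R : realType)
    (m1 : {sigma_finite_measure set T1 -> \bar R})
    (m2 : {sigma_finite_measure set T2 -> \bar R}) :
  sigma_finite setT (m1 \x m2)%E.
Proof.
have /sigma_finiteP[F [TF ndF Foo]] := sigma_finiteT m1.
have /sigma_finiteP[G [TG ndG Goo]] := sigma_finiteT m2.
exists (fun n => F n `*` G n).
  rewrite -setXTT TF TG predeqE => -[x y]; split.
    move=> [/= [n _ Fnx] [k _ Gky]]; exists (maxn n k) => //; split.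
    - by move: x Fnx; exact/subsetPset/ndF/leq_maxl.
    - by move: y Gky; exact/subsetPset/ndG/leq_maxr.
  by move=> [n _ []/= ? ?]; split; exists n.
move=> k; have [? ?] := Foo k; have [? ?] := Goo k.
split; first exact: measurableX.
by rewrite product_measure1E// lte_mul_pinfty// ge0_fin_numE.
Qed.

Section Space.
Context {R : realType}.

Definition leb2 : set (measurableTypeR R * measurableTypeR R) -> \bar R :=
  (@lebesgue_measure R \x @lebesgue_measure R)%E.

HB.instance Definition _ := Measure.on leb2.
HB.instance Definition _ := Measure_isSigmaFinite.Build _ _ _ leb2
  (product_measure_sigma_finite _ _).

Definition leb3 : set (R3 R) -> \bar R := (leb2 \x @lebesgue_measure R)%E.
HB.instance Definition _ := Measure.on leb3.
HB.instance Definition _ := Measure_isSigmaFinite.Build _ _ _ leb3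
  (product_measure_sigma_finite _ _).

Definition coord (i : 'I_3) (x : R3 R) : R := [:: x.1.1; x.1.2; x.2]`_i.

Definition unit_vec (i : 'I_3) : R3 R :=
  ((i == 0 :> nat)%:R, (i == 1 :> nat)%:R, (i == 2 :> nat)%:R).

Definition enorm (x : R3 R) : R := Num.sqrt (\sum_(i < 3) coord i x ^+ 2).

End Space.

Section Sobolev.
Context {R : realType}.
Implicit Types (phi psi : R3 R -> R) (g : R3 R -> R3 R).

(* [C^k] via continuity of all iterated partial derivatives of order at most
   [k]. *)
Fixpoint Ck (k : nat) (psi : R3 R -> R) : Prop :=
  if k is k'.+1 then
    continuous psi /\ forall i : 'I_3,
      (forall x, derivable psi x (unit_vec i)) /\ Ck k' ('D_(unit_vec i) psi)
  else continuous psi.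

Definition test_function psi :=
  (forall k, Ck k psi) /\ compact (closure [set x | psi x != 0]).

Definition L2_weak_gradient phi g :=
  (forall i, coord i \o g \in Lfun leb3 2%:E) /\
  forall psi, test_function psi -> forall i : 'I_3,
    (\int[leb3]_x (phi x * 'D_(unit_vec i) psi x)%:E =
     - \int[leb3]_x (coord i (g x) * psi x)%:E)%E.

Definition H1 : set (R3 R -> R) :=
  [set phi | phi \in Lfun leb3 2%:E /\ exists g, L2_weak_gradient phi g].

(* Weak gradients are unique up to null sets; [grad phi] is a representative
   (and the junk value 0 if [phi] has no square-integrable weak gradient). *)
Definition grad phi : R3 R -> R3 R :=
  xget (fun=> (0, 0, 0)) [set g | L2_weak_gradient phi g].

Definition energy (beta : R) phi : \bar R :=
  ((2^-1)%:E * 'N[leb3]_2%:E[EFin \o enorm \o grad phi] ^+ 2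
   + beta%:E * 'N[leb3]_1[EFin \o phi])%E.

Definition admissible : set (R3 R -> R) :=
  [set phi | [/\ H1 phi, phi \in Lfun leb3 1 &
                 ('N[leb3]_2%:E[EFin \o phi] = 1)%E]].

Definition Fmin (beta : R) : \bar R :=
  ereal_inf [set energy beta phi | phi in admissible].

Definition minimizer (beta : R) phi :=
  admissible phi /\
  forall psi, admissible psi -> (energy beta phi <= energy beta psi)%E.

(* The open ball centred at 0 with the same Lebesgue measure as [A] (all of
   space if that measure is infinite), since [4/3 * pi * |x|^3] is the measure
   of the ball of radius [|x|]. *)
Definition set_rearrangement (A : set (R3 R)) : set (R3 R) :=
  [set x | ((4 / 3 * pi * enorm x ^+ 3)%:E < leb3 A)%E].

(* Layer-cake formula. *)
Definition rearrangement phi (x : R3 R) : \bar R :=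
  (\int[lebesgue_measure]_(t in `]0%R, +oo[)
     (\1_(set_rearrangement [set y | t < `|phi y|]) x)%:E)%E.

Definition rearranged phi :=
  {ae leb3, forall x, (phi x)%:E = rearrangement phi x}.

End Sobolev.

Section Profile.
Context {R : realType}.

Definition sinc (x : R) : R := if x == 0 then 1 else sin x / x.

Definition profile (beta a mu rad : R) (r : R) : R :=
  if r <= rad then a * sinc (mu * r) + beta / mu ^+ 2 else 0.

Definition first_zero (f : R -> R) (rad : R) :=
  [/\ 0 < rad, f rad = 0 & forall r, 0 < r -> f r = 0 -> rad <= r].

(* The piecewise profile vanishes beyond [rad], so the two-sided derivative
   condition at [rad] says that its left derivative there is 0.  The
   normalization is part of [admissible], hence of [minimizer]. *)
Definition minimizer_parameters (beta a mu rad : R) :=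
  let f := profile beta a mu rad in
  [/\ 0 < a, 0 < mu, first_zero f rad, is_derive rad 1 f 0 &
      minimizer beta (f \o enorm) /\ rearranged (f \o enorm)].

End Profile.

(* Main.v *)
From HB Require Import structures.
Require Import Defs.
From mathcomp Require Import ring.
Local Open Scope classical_set_scope.
Local Open Scope ring_scope.

Set Implicit Arguments.
Unset Strict Implicit.
Unset Printing Implicit Defensive.

(** The minimizer for [beta] is a rescaling of the one for [beta = 1].

    Put [t = mu * rad].  The three conditions on the profile force
    [a * sinc t + beta / mu ^ 2 = 0] and [sinc' t = 0], that is
    [sin t = t * cos t], and say that [sinc] does not take the value [sinc t]
    on ]0, t[.  At a critical point [sinc t = cos t] and
    [cos t ^ 2 = 1 / (1 + t ^ 2)], so among the critical points with a negative
    value a later one lies strictly higher; by the intermediate value theorem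
    its value is already taken before the earlier one.  Hence [t] is one and
    the same number for all [beta] ([sinc_level_le]), and with
    [l = mu beta / mu 1] and [s = beta / l ^ 2] the profile for [beta] is
    [r |-> s * profile 1 (l * r)] ([profile_rescale]).

    Lebesgue measure on R^3 scales by [l ^ -3] ([integral_dilation]), so both
    profiles can have L^2 norm 1 only if [s ^ 2 = l ^ 3]; together with
    [beta = s * l ^ 2] this gives [l = beta ^ (2 / 7)] and
    [s = beta ^ (3 / 7)] ([scale_exponents]), hence the three power laws.  For
    such [s] and [l] both terms of the energy are multiplied by
    [l ^ 2 = beta ^ (4 / 7)] ([energy_rescale]), and the minimal energy is the
    energy of the minimizer.

    The gradient term needs an argument because [grad] selects an arbitrary
    weak gradient: the rescaled gradient of the minimizer for [beta = 1] is a
    weak gradient of the minimizer for [beta], but it need not be the selected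
    one.  So weak gradients are shown to be unique almost everywhere
    ([weak_gradient_ae_unique]).  The difference of two of them is orthogonal
    to all test functions; smooth bumps increasing to the indicator of a box
    show that its integral over every box vanishes, and boxes form a pi-system
    generating the Borel sets. *)

(** * Lebesgue measure under dilations *)

Section DilationMeasure.
Local Open Scope ereal_scope.

Lemma lebesgue_measure_preimage_mul (R : realType) (l : R)
    (A : set (measurableTypeR R)) :
  (0 < l)%R -> measurable A ->
  lebesgue_measure (( *%R l : measurableTypeR R -> measurableTypeR R) @^-1` A) =
  (l^-1)%:E * lebesgue_measure A.
Proof.
move=> l0 mA.
have ml : measurable_fun setT ( *%R l : measurableTypeR R -> measurableTypeR R).
  exact: mulrl_measurable.
pose ml_mixin := isMeasurableFun.Build _ _ _ _ _ ml.
pose f : {mfun measurableTypeR R >-> measurableTypeR R} :=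
  HB.pack ( *%R l : measurableTypeR R -> measurableTypeR R) ml_mixin.
pose k : {nonneg R} := NngNum (ltW l0).
have -> := @lebesgue_measure_unique R (mscale k (pushforward lebesgue_measure f)) _ _ mA.
  by rewrite /mscale /= muleA -EFinM mulVf ?gt_eqF// mul1e.
move=> X [[a b] _ <-] /=.
rewrite /mscale /= /pushforward.
have -> : (f @^-1` `]a, b]%classic = `](l^-1 * a)%R, (l^-1 * b)%R]%classic)%R.
  apply/seteqP; split => x /=; rewrite !in_itv/= !ler_pdivlMl// !ltr_pdivrMl//.
rewrite !lebesgue_measure_itv/= !lte_fin ltr_pM2l ?invr_gt0//.
case: ifPn => _; last by rewrite mule0.
by rewrite -EFinD -EFinM mulrBr !mulVKf ?gt_eqF.
Qed.

(** By uniqueness of the product measure, two maps that multiply measures by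
    constants act on the product by the product of the constants. *)
Lemma product_measure_preimage d1 d2 (T1 : measurableType d1)
    (T2 : measurableType d2) (R : realType)
    (m1 : {sigma_finite_measure set T1 -> \bar R})
    (m2 : {sigma_finite_measure set T2 -> \bar R})
    (f1 : T1 -> T1) (f2 : T2 -> T2) (c1 c2 : R) :
  measurable_fun setT f1 -> measurable_fun setT f2 ->
  (0 < c1)%R -> (0 < c2)%R ->
  (forall A, measurable A -> m1 (f1 @^-1` A) = c1%:E * m1 A) ->
  (forall A, measurable A -> m2 (f2 @^-1` A) = c2%:E * m2 A) ->
  forall A, measurable A ->
    (m1 \x m2) ((fun x => (f1 x.1, f2 x.2)) @^-1` A) =
    (c1 * c2)%:E * (m1 \x m2) A.
Proof.
move=> mf1 mf2 c10 c20 m1E m2E A mA.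
pose f (x : T1 * T2) := (f1 x.1, f2 x.2).
have mf : measurable_fun setT f.
  apply: measurable_fun_pair.
  - exact: measurableT_comp mf1 _.
  - exact: measurableT_comp mf2 _.
pose f_mixin := isMeasurableFun.Build _ _ _ _ _ mf.
pose F : {mfun (T1 * T2)%type >-> (T1 * T2)%type} := HB.pack f f_mixin.
have cancel (x y : \bar R) :
    ((c1 * c2)^-1)%:E * ((c1%:E * x) * (c2%:E * y)) = x * y.
  rewrite -muleA (muleCA x) !muleA -!EFinM -mulrA mulVf ?mul1e//.
  by rewrite gt_eqF// mulr_gt0.
have c0 : (0 < (c1 * c2)^-1)%R by rewrite invr_gt0 mulr_gt0.
pose k : {nonneg R} := NngNum (ltW c0).
rewrite [in RHS](@product_measure_unique _ _ _ _ _ m1 m2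
  (mscale k (pushforward (m1 \x m2) F)))//.
  by rewrite /mscale /= muleA -EFinM mulfV ?gt_eqF ?mulr_gt0// mul1e.
move=> X Y mX mY.
transitivity (((c1 * c2)^-1)%:E * (m1 \x m2) ((f1 @^-1` X) `*` (f2 @^-1` Y))).
  by [].
rewrite product_measure1E.
- transitivity (((c1 * c2)^-1)%:E * ((c1%:E * m1 X) * (c2%:E * m2 Y))).
    by rewrite -m1E// -m2E.
  exact: cancel.
- by rewrite -[X in measurable X]setTI; exact: mf1.
- by rewrite -[X in measurable X]setTI; exact: mf2.
Qed.

Lemma measurable_dilation (R : realType) (l : R) :
  measurable_fun setT (fun x : R3 R => (l *: x : R3 R)).
Proof.
have ml : measurable_fun setT ( *%R l : measurableTypeR R -> measurableTypeR R).
  exact: mulrl_measurable.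
apply: measurable_fun_pair.
  apply: measurable_fun_pair.
  - by do 2 apply: measurableT_comp => //.
  - by do 2 apply: measurableT_comp => //.
by apply: measurableT_comp.
Qed.

Lemma leb3_preimage_dilation (R : realType) (l : R) (A : set (R3 R)) :
  (0 < l)%R -> measurable A ->
  leb3 ((fun x : R3 R => (l *: x : R3 R)) @^-1` A) = (l ^- 3)%:E * leb3 A.
Proof.
move=> l0 mA.
have ml : measurable_fun setT ( *%R l : measurableTypeR R -> measurableTypeR R).
  exact: mulrl_measurable.
have li0 : (0 < l^-1)%R by rewrite invr_gt0.
have -> : (l ^- 3 = l^-1 * l^-1 * l^-1)%R by rewrite -exprVn !exprS expr0 mulr1 mulrA.
apply: (@product_measure_preimage _ _ _ _ R leb2 lebesgue_measure
  (fun x => (l * x.1, l * x.2)%R) ( *%R l)) => //.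
- apply: measurable_fun_pair.
  - by apply: measurableT_comp.
  - by apply: measurableT_comp.
- by rewrite mulr_gt0.
- move=> B mB; apply: product_measure_preimage => //.
  + by move=> *; exact: lebesgue_measure_preimage_mul.
  + by move=> *; exact: lebesgue_measure_preimage_mul.
- by move=> *; exact: lebesgue_measure_preimage_mul.
Qed.

Lemma ge0_integral_dilation (R : realType) (l : R) (f : R3 R -> \bar R) :
  (0 < l)%R -> measurable_fun setT f -> (forall x, 0 <= f x) ->
  \int[leb3]_x f (l *: x)%R = (l ^- 3)%:E * \int[leb3]_x f x.
Proof.
move=> l0 mf f0.
have l30 : (0 < l ^- 3)%R by rewrite invr_gt0 exprn_gt0.
have := @ge0_integral_pushforward _ _ _ _ R _ (measurable_dilation l) leb3 setT f
   measurableT mf (fun y _ => f0 y).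
rewrite preimage_setT => <-.
rewrite -(@ge0_integral_mscale _ _ R leb3 setT measurableT (NngNum (ltW l30)))//.
apply: eq_measure_integral => [|mf' A mA _]; first exact: measurable_dilation.
exact: leb3_preimage_dilation.
Qed.

(** The positive and the negative part scale separately; as [l ^- 3] is positive
    and finite, multiplication by it distributes over their difference even
    when both integrals are infinite. *)
Lemma integral_dilation (R : realType) (l : R) (f : R3 R -> \bar R) :
  (0 < l)%R -> measurable_fun setT f ->
  \int[leb3]_x f (l *: x)%R = (l ^- 3)%:E * \int[leb3]_x f x.
Proof.
move=> l0 mf.
have l30 : (0 < l ^- 3)%R by rewrite invr_gt0 exprn_gt0.
rewrite [in RHS]integralE.
transitivity ((l ^- 3)%:E * (\int[leb3]_x f^\+ x) - (l ^- 3)%:E * (\int[leb3]_x f^\- x)).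
  rewrite -(ge0_integral_dilation l0 (measurable_funepos mf) (funepos_ge0 f)).
  rewrite -(ge0_integral_dilation l0 (measurable_funeneg mf) (funeneg_ge0 f)).
  rewrite [LHS]integralE.
  by congr (_ - _); apply: eq_integral => x _; rewrite ?funeposE ?funenegE.
have : 0 <= \int[leb3]_x f^\+ x by apply: integral_ge0 => x _; exact: funepos_ge0.
have : 0 <= \int[leb3]_x f^\- x by apply: integral_ge0 => x _; exact: funeneg_ge0.
case: (\int[leb3]_x (f^\-) x) => [b||]//; case: (\int[leb3]_x (f^\+) x) => [a||]// _ _.
- by rewrite -!EFinM -!EFinB mulrBr.
- by rewrite gt0_muley ?lte_fin//= gt0_muley ?lte_fin.
- by rewrite gt0_muley ?lte_fin//= gt0_muleNy ?lte_fin.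
- by rewrite gt0_muley ?lte_fin//= gt0_muleNy ?lte_fin.
Qed.

End DilationMeasure.

(** * Smooth functions on R^3 *)

Section DirectionalDerivative.
Context {R : realType} {V W : normedModType R}.

(** A chain rule for directional derivatives, covering both precomposition with
    a dilation and a function of one coordinate; [m = 0] occurs in the latter
    case, for the directions along which that coordinate is constant. *)
Lemma is_derive_affine_line (F : V -> R) (G : W -> R) (x v : V) (y w : W) (m d : R) :
  (forall h, F (h *: v + x) = G ((m * h) *: w + y)) ->
  is_derive y w G d -> is_derive x v F (m * d).
Proof.
move=> FG [dG Gd].
have FGx : F x = G y by have := FG 0; rewrite mulr0 !scale0r !add0r.
suff cF : (fun h => h^-1 *: ((F \o shift x) (h *: v) - F x)) @ (0 : R)^' --> (m * d : R).
  apply: DeriveDef; first by apply/cvg_ex; exists (m * d).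
  exact: cvg_lim cF.
have [m0|m0] := eqVneq m 0.
  rewrite m0 mul0r; apply: cvg_near_cst; apply: nearW => h /=.
  by rewrite FG m0 mul0r scale0r add0r FGx subrr scaler0.
have cG : (fun h => h^-1 *: ((G \o shift y) (h *: w) - G y)) @ (0 : R)^' --> (d : R).
  by rewrite -Gd; exact: dG.
have cm : ( *%R m) @ (0 : R)^' --> (0 : R)^'.
  rewrite -{2}(mulr0 m); apply: continuous_injective_withinNx.
    exact: mulrl_continuous.
  by move=> h /(mulfI m0).
have -> : (fun h => h^-1 *: ((F \o shift x) (h *: v) - F x)) =
  (fun h => m * (((fun h => h^-1 *: ((G \o shift y) (h *: w) - G y)) \o ( *%R m)) h)).
  apply/funext => h /=; rewrite FG FGx.
  have [->|h0] := eqVneq h 0; first by rewrite mulr0 !scale0r add0r subrr !scaler0 mulr0.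
  by rewrite invfM -[RHS]/(m * ((m^-1 * h^-1) * _)) !mulrA mulfV// mul1r.
by apply: cvgM; [exact: cvg_cst|exact: cvg_comp cm cG].
Qed.

End DirectionalDerivative.

Section Ck.
Context {R : realType}.
Implicit Types f g psi : R3 R -> R.

Lemma Ck_continuous k f : Ck k f -> continuous f.
Proof. by case: k => [|k] // []. Qed.

Lemma Ck_lower k f : Ck k.+1 f -> Ck k f.
Proof.
elim: k f => [f /Ck_continuous//|k IH f [cf df]]; split=> // i.
by have [? ?] := df i; split=> //; exact: IH.
Qed.

Lemma Ck_add k f g : Ck k f -> Ck k g -> Ck k (f + g).
Proof.
elim: k f g => [|k IH] f g /=.
  by move=> cf cg x; apply: continuousD; [exact: cf|exact: cg].
move=> [cf df] [cg dg]; split=> [x|i].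
  by apply: continuousD; [exact: cf|exact: cg].
have [dfi Cf] := df i; have [dgi Cg] := dg i; split=> [x|]; first exact: derivableD.
rewrite (_ : 'D__ _ = 'D_(unit_vec i) f + 'D_(unit_vec i) g); first exact: IH.
by apply/funext => x; rewrite deriveD.
Qed.

Lemma Ck_mul k f g : Ck k f -> Ck k g -> Ck k (f * g).
Proof.
elim: k f g => [|k IH] f g.
  by move=> cf cg x; apply: continuousM; [exact: cf|exact: cg].
move=> Cf Cg; have [cf df] := Cf; have [cg dg] := Cg; split=> [x|i].
  by apply: continuousM; [exact: cf|exact: cg].
have [dfi Cfi] := df i; have [dgi Cgi] := dg i; split=> [x|]; first exact: derivableM.
rewrite (_ : 'D__ _ = f * 'D_(unit_vec i) g + g * 'D_(unit_vec i) f).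
  by apply: Ck_add; apply: IH => //; exact: Ck_lower.
by apply/funext => x; rewrite deriveM.
Qed.

Lemma derive_scaled_dilation f (c l : R) x v : derivable f (l *: x : R3 R) v ->
  is_derive x v (fun y : R3 R => c * f (l *: y)) (c * l * 'D_v f (l *: x)).
Proof.
move=> df; have df' : is_derive (l *: x : R3 R) v f ('D_v f (l *: x)) by apply: DeriveDef.
rewrite -mulrA; apply: is_deriveZ; apply: is_derive_affine_line df' => h.
by rewrite scalerDr scalerA.
Qed.

(** Each derivative of [x |-> c * f (l *: x)] has the same form with [c]
    replaced by [c * l], hence the constant in the induction. *)
Lemma Ck_scaled_dilation k f (c l : R) : Ck k f -> Ck k (fun x : R3 R => c * f (l *: x)).
Proof.
have cont (h : R3 R -> R) (a : R) : continuous h -> continuous (fun x : R3 R => a * h (l *: x) : R).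
  move=> ch x; apply: cvgM; first exact: cvg_cst.
  apply: (continuous_comp (f := fun y : R3 R => l *: y)); last exact: ch.
  exact: scaler_continuous.
elim: k f c => [|k IH] f c /=; first exact: cont.
move=> [cf df]; split=> [|i]; first exact: cont.
have [dfi Cfi] := df i.
have D x := derive_scaled_dilation c (dfi (l *: x)).
split=> [x|]; first by have [] := D x.
rewrite (_ : 'D__ _ = (fun x : R3 R => (c * l) * 'D_(unit_vec i) f (l *: x)));
  first exact: (IH _ (c * l) Cfi).
by apply/funext => x; have [_ e] := D x; exact: e.
Qed.

End Ck.

(** * Smooth bumps supported in boxes *)

Section Flat.
Context {R : realType}.

(** The functions [p(1/x) * exp(-1/x)], extended by 0 to [x <= 0], are closed
    under differentiation, which makes them smooth.  The case [p = 1] is the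
    usual flat function. *)
Definition flat (p : {poly R}) (x : R) : R :=
  if 0 < x then p.[x^-1] * expR (- x^-1) else 0.

Definition flat_deriv (p : {poly R}) : {poly R} := 'X^2 * (p - p^`()).

(** Each monomial [y ^ i] is at most [i! * exp y]. *)
Lemma horner_expR_bound (p : {poly R}) :
  exists2 C : R, 0 <= C & forall y, 0 <= y -> `|p.[y]| <= C * expR y.
Proof.
exists (\sum_(i < size p) `|p`_i| * i`!%:R).
  by apply: sumr_ge0 => i _; rewrite mulr_ge0.
move=> y y0; rewrite horner_coef; apply: le_trans (ler_norm_sum _ _ _) _.
rewrite mulr_suml; apply: ler_sum => i _.
rewrite normrM -mulrA ler_wpM2l// ger0_norm ?exprn_ge0//.
case: i => -[|i] _ /=.
  rewrite expr0 fact0 mul1r; apply: le_trans (expR_ge1Dx y).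
  by rewrite lerDl.
rewrite -ler_pdivrMl ?ltr0n ?fact_gt0// mulrC.
by apply: le_trans (expR_ge1Dxn i y0); rewrite lerDr.
Qed.

(** Applying the previous bound to [p * 'X] gains the factor [x]. *)
Lemma flat_bound (p : {poly R}) :
  exists2 C : R, 0 <= C & forall x, `|flat p x| <= C * `|x|.
Proof.
have [C C0 hC] := horner_expR_bound (p * 'X); exists C => // x; rewrite /flat.
case: ifPn => [x0|_]; last by rewrite normr0 mulr_ge0.
have xi0 : 0 <= x^-1 by rewrite invr_ge0 ltW.
have := hC _ xi0; rewrite hornerMX !normrM !(gtr0_norm x0) (ger0_norm xi0).
rewrite ler_pdivrMr// mulrAC expRN.
rewrite (gtr0_norm (_ : 0 < (expR _)^-1)) ?invr_gt0 ?expR_gt0//.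
by rewrite ler_pdivrMr ?expR_gt0.
Qed.

Lemma flat_is_derive (p : {poly R}) (x : R) :
  is_derive x 1 (flat p) (flat (flat_deriv p) x).
Proof.
have [x0|x0|x0] := ltgtP x 0.
- rewrite {2}/flat lt_gtF//.
  apply: (@near_eq_is_derive _ _ _ (cst 0)) => /=.
  near=> y; rewrite /flat lt_gtF//.
  by near: y; exact: lt_nbhsl.
- rewrite {2}/flat x0 /flat_deriv.
  apply: (@near_eq_is_derive _ _ _
    ((horner p \o @GRing.inv R) * (expR \o (fun x => - x^-1)))) => /=.
    near=> y; rewrite /flat ifT//.
    by near: y; exact: lt_nbhsr.
  have xn0 : x != 0 by rewrite gt_eqF.
  have Dinv : is_derive x 1 (@GRing.inv R) (- x ^- 2).
    by have := @is_deriveV R id x 1 1 xn0 _; rewrite /GRing.scale/= mulr1; apply.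
  have D1 : is_derive x 1 (horner p \o @GRing.inv R) (p^`().[x^-1] * (- x ^- 2)).
    exact: is_derive1_comp.
  have D2 : is_derive x 1 (expR \o (fun x => - x^-1) : R -> R) (expR (- x^-1) * (x ^- 2)).
    by apply: is_derive1_comp; rewrite -[x ^- 2]opprK; exact: is_deriveN.
  apply: is_derive_eq.
  rewrite /GRing.scale/= !hornerE/= exprVn. ring.
- rewrite x0 {2}/flat ltxx.
  (* For h > 0 the difference quotient of [flat p] at 0 is [flat (p * 'X) h]. *)
  have [C C0 hC] := flat_bound (p * 'X).
  have f0 : flat p 0 = 0 by rewrite /flat ltxx.
  suff cF : (fun h => h^-1 *: ((flat p \o shift 0) (h *: 1) - flat p 0)) @ (0 : R)^' --> (0 : R).
    apply: DeriveDef; first by apply/cvg_ex; exists 0.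
    exact: cvg_lim cF.
  have C1 : 0 < C + 1 by rewrite ltr_wpDl.
  apply/cvgrPdist_le => e e0; near=> h.
  rewrite f0 subr0 sub0r normrN /= addr0 /GRing.scale/= mulr1.
  apply: (@le_trans _ _ (C * `|h|)).
    apply: le_trans (hC h); rewrite /flat; case: ifPn => h0; last by rewrite mulr0.
    by rewrite hornerMX mulrCA mulrA.
  apply: (@le_trans _ _ ((C + 1) * `|h|)); first by rewrite ler_wpM2r// lerDl.
  rewrite -ler_pdivlMl//; near: h; apply: dnbhs0_le.
  by apply: mulr_gt0 => //; rewrite invr_gt0. 
Unshelve. all: by end_near.
Qed.

End Flat.

Section Bump.
Context {R : realType}.

Lemma coordZD (i : 'I_3) (h : R) (v x : R3 R) :
  coord i (h *: v + x) = h * coord i v + coord i x.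
Proof. by case: i => -[|[|[|]]]. Qed.

Lemma continuous_coord (i : 'I_3) : continuous (coord i : R3 R -> R).
Proof.
have c1 : continuous (fun x : R3 R => x.1.1 : R).
  by move=> x; apply: continuous_comp; exact: cvg_fst.
have c2 : continuous (fun x : R3 R => x.1.2 : R).
  by move=> x; apply: continuous_comp; [exact: cvg_fst|exact: cvg_snd].
have c3 : continuous (fun x : R3 R => x.2 : R) by move=> x; exact: cvg_snd.
by case: i => -[|[|[|]]].
Qed.

Lemma continuous_flat (p : {poly R}) : continuous (flat p).
Proof.
move=> x; apply/differentiable_continuous/derivable1_diffP.
by have [] := flat_is_derive p x.
Qed.

Lemma Ck_flat_affine k p (i : 'I_3) (a c d : R) :
  Ck k (fun x : R3 R => a * flat p (c * coord i x + d)).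
Proof.
have cont p' a' : continuous (fun x : R3 R => a' * flat p' (c * coord i x + d)).
  move=> x; apply: cvgM; first exact: cvg_cst.
  apply: (continuous_comp (f := fun x : R3 R => c * coord i x + d)); last exact: continuous_flat.
  apply: cvgD; last exact: cvg_cst.
  by apply: cvgM; [exact: cvg_cst|exact: continuous_coord].
have aff (h v y : R) : c * (h * v + y) + d = c * v * h * 1 + (c * y + d) by ring.
elim: k p a => [|k IH] p a; first exact: cont.
split=> [|j]; first exact: cont.
have D (x : R3 R) : is_derive x (unit_vec j) (fun x : R3 R => a * flat p (c * coord i x + d))
   ((c * coord i (unit_vec j)) * (a * flat (flat_deriv p) (c * coord i x + d))).
  apply: (@is_derive_affine_line _ _ _ _ (fun t : R => a * flat p t) _ _ _ 1).
    by move=> h; rewrite coordZD /GRing.scale/=; congr (_ * flat _ _); exact: aff.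
  by apply: is_deriveZ; exact: flat_is_derive.
split=> [x|]; first by have [] := D x.
rewrite (_ : 'D__ _ = (fun x : R3 R =>
  (c * coord i (unit_vec j) * a) * flat (flat_deriv p) (c * coord i x + d))) //.
by apply/funext => x; have [_ ->] := D x; rewrite mulrA.
Qed.

Definition box (a b : R3 R) : set (R3 R) :=
  (`]a.1.1, b.1.1[ `*` `]a.1.2, b.1.2[) `*` `]a.2, b.2[.

Lemma boxP (a b x : R3 R) : box a b x <-> forall i, coord i a < coord i x < coord i b.
Proof.
rewrite /box /=; split=> [[[]]|H].
  by rewrite /= !in_itv/= => ? ? ? [[|[|[|]]]].
by rewrite !in_itv/=; split; [split|];
  [exact: (H ord0)|exact: (H (@Ordinal 3 1 isT))|exact: (H (@Ordinal 3 2 isT))].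
Qed.

Lemma measurable_box (a b : R3 R) : measurable (box a b).
Proof. by apply: measurableX; [apply: measurableX|]; exact: measurable_itv. Qed.

(** [n] sharpens the transition: [flat 1 (n * x)] tends to the indicator of
    [x > 0], so these bumps tend to the indicator of the box. *)
Definition bump (a b : R3 R) (n : nat) (x : R3 R) : R :=
  \prod_(i < 3) (flat 1 (n%:R * (coord i x - coord i a)) *
                 flat 1 (n%:R * (coord i b - coord i x))).

Lemma flat1E (x : R) : flat 1 x = if 0 < x then expR (- x^-1) else 0.
Proof. by rewrite /flat hornerC mul1r. Qed.

Lemma flat1_ge0 (x : R) : 0 <= flat 1 x.
Proof. by rewrite flat1E; case: ifP => // _; exact: expR_ge0. Qed.

Lemma flat1_le1 (x : R) : flat 1 x <= 1.
Proof.
rewrite flat1E; case: ifP => // x0.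
by rewrite -expR0 ler_expR oppr_le0 invr_ge0 ltW.
Qed.

Lemma bump_ge0 a b n x : 0 <= bump a b n x.
Proof. by apply: prodr_ge0 => i _; rewrite mulr_ge0 ?flat1_ge0. Qed.

Lemma bump_le1 a b n x : bump a b n x <= 1.
Proof.
by apply: prodr_ile1 => i _; rewrite mulr_ge0 ?flat1_ge0//= mulr_ile1 ?flat1_ge0 ?flat1_le1.
Qed.

Lemma bump_eq0 a b n x : ~ box a b x -> bump a b n x = 0.
Proof.
move=> Nx; have [i] : exists i, ~~ (coord i a < coord i x < coord i b).
  by apply: contra_notP Nx => /forallNP H; apply/boxP => i; apply: contrapT => /negP; exact: H.
rewrite negb_and -!leNgt => Hi; rewrite /bump (bigD1 i)//= !flat1E.
have n0 : 0 <= n%:R :> R by [].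
case/orP : Hi => Hi.
- by rewrite [X in X * _ * _]ifF ?mul0r//;
  apply/negbTE; rewrite -leNgt mulr_ge0_le0// subr_le0.
- by rewrite [X in _ * X * _]ifF ?mulr0 ?mul0r//;
  apply/negbTE; rewrite -leNgt mulr_ge0_le0// subr_le0.
Qed.

Lemma cvg_flat1 (x : R) : 0 < x -> flat 1 (n%:R * x) @[n --> \oo] --> (1 : R).
Proof.
move=> x0.
rewrite -(cvg_shiftS (fun n => flat 1 (n%:R * x))) /=.
have -> : (fun n => flat 1 (n.+1%:R * x)) = (fun n => expR (- (x^-1 * n.+1%:R^-1))).
  by apply/funext => n; rewrite flat1E mulr_gt0// invfM mulrC.
rewrite -{2}expR0.
apply: (cvg_comp _ expR); last exact: continuous_expR.
rewrite -oppr0; apply: cvgN; rewrite -(mulr0 x^-1).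
apply: cvgM; [exact: cvg_cst|exact: cvg_harmonic].
Qed.

Lemma cvg_bump a b x : box a b x -> bump a b n x @[n --> \oo] --> (1 : R).
Proof.
move=> /boxP ab.
have -> : (1 : R) = \prod_(i < 3) (1 * 1) by rewrite big1// => i _; rewrite mulr1.
apply: cvg_big => [|i _]; first by exact: mul_continuous.
by apply: cvgM; apply: cvg_flat1; rewrite subr_gt0; have /andP[] := ab i.
Qed.

Lemma test_function_bump a b n : test_function (bump a b n).
Proof.
split=> [k|].
  have pulse i : Ck k (fun x : R3 R => flat 1 (n%:R * (coord i x - coord i a)) *
                 flat 1 (n%:R * (coord i b - coord i x))).
    apply: (@Ck_mul _ _ (fun x => flat 1 (n%:R * (coord i x - coord i a)))
      (fun x => flat 1 (n%:R * (coord i b - coord i x)))).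
      rewrite (_ : (fun x => _) = (fun x =>
          1 * flat 1 (n%:R * coord i x + (- (n%:R * coord i a))))).
        exact: Ck_flat_affine.
      by apply/funext => x; rewrite mul1r mulrBr.
    rewrite (_ : (fun x => _) = (fun x =>
        1 * flat 1 (- n%:R * coord i x + n%:R * coord i b))).
      exact: Ck_flat_affine.
    by apply/funext => x; rewrite mul1r mulrBr addrC mulNr.
  pose P i := (fun x : R3 R => flat 1 (n%:R * (coord i x - coord i a)) *
                 flat 1 (n%:R * (coord i b - coord i x))).
  rewrite (_ : bump a b n = P ord0 * (P (lift ord0 ord0) * P (lift ord0 (lift ord0 ord0)))).
    by apply: Ck_mul; [exact: pulse|apply: Ck_mul; exact: pulse].
  by apply/funext => x; rewrite /bump !big_ord_recl big_ord0 mulr1.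
pose K : set (R3 R) := (`[a.1.1, b.1.1] `*` `[a.1.2, b.1.2]) `*` `[a.2, b.2].
have cK : compact K.
  by apply: compact_setX; [apply: compact_setX|]; exact: segment_compact.
have KC : closed K.
  by apply: compact_closed => //; exact: norm_hausdorff.
apply: (subclosed_compact _ cK); first exact: closed_closure.
have -> : K = closure K by apply/closure_id.
apply: closureS => x /= bx.
have : box a b x by apply: contrapT => /bump_eq0 b0; rewrite b0 eqxx in bx.
by move=> [[/= ? ?] ?]; split; [split|]; exact: subset_itv_oo_cc.
Qed.

End Bump.

(** * Functions with vanishing integrals over a generating pi-system *)

Section ProductGenerated.
Context d1 d2 (T1 : measurableType d1) (T2 : measurableType d2).
Variables (G1 : set (set T1)) (G2 : set (set T2)).
Variables (g1 : (set T1)^nat) (g2 : (set T2)^nat).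
Hypotheses (mG1 : @measurable _ T1 = <<s G1>>) (mG2 : @measurable _ T2 = <<s G2>>).
Hypotheses (Gg1 : forall n, G1 (g1 n)) (Gg2 : forall n, G2 (g2 n)).
Hypotheses (cover1 : \bigcup_n g1 n = setT) (cover2 : \bigcup_n g2 n = setT).

(** The covers are needed to write a cylinder [A `*` setT] as a countable union
    of rectangles from the two generators. *)
Lemma measurable_prod_generated :
  @measurable _ (T1 * T2)%type = <<s [set A `*` B | A in G1 & B in G2]>>.
Proof.
set G := [set _ `*` _ | _ in _ & _ in _].
have sG : sigma_algebra setT <<s G>> by exact: smallest_sigma_algebra.
rewrite eqEsubset; split; last first.
  apply: smallest_sub; first exact: sigma_algebra_measurable.
  by move=> _ [A GA] [B GB] <-; apply: measurableX; rewrite ?mG1 ?mG2; exact: sub_sigma_algebra.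
have cyl1 A : measurable A -> <<s G>> (A `*` setT).
  rewrite mG1; apply: (@smallest_sub _ _ _ [set A | <<s G>> (A `*` setT)]).
    split => [|B /= GB|F /= GF].
    - by rewrite /= set0X; have [] := sG.
    - have [_ sD _] := sG; have := sD _ GB.
      by congr (<<s G>>); apply/seteqP; split => -[x y] /=; tauto.
    - have [_ _ sU] := sG; have := sU _ GF.
      by congr (<<s G>>); apply/seteqP; split => -[x y] /=;
        [move=> [n _ [? _]]; split => //; exists n|move=> [[n _ ?] _]; exists n].
  move=> B GB /=; rewrite -cover2 setX_bigcupr.
  have [_ _ sU] := sG; apply: sU => n; apply: sub_sigma_algebra.
  by exists B => //; exists (g2 n).
have cyl2 B : measurable B -> <<s G>> (setT `*` B).
  rewrite mG2; apply: (@smallest_sub _ _ _ [set B | <<s G>> (setT `*` B)]).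
    split => [|B' /= GB|F /= GF].
    - by rewrite /= setX0; have [] := sG.
    - have [_ sD _] := sG; have := sD _ GB.
      by congr (<<s G>>); apply/seteqP; split => -[x y] /=; tauto.
    - have [_ _ sU] := sG; have := sU _ GF.
      by congr (<<s G>>); apply/seteqP; split => -[x y] /=;
        [move=> [n _ [? ?]]; split => //; exists n|move=> [_ [n _ ?]]; exists n].
  move=> B' GB /=; rewrite -cover1 setX_bigcupl.
  have [_ _ sU] := sG; apply: sU => n; apply: sub_sigma_algebra.
  by exists (g1 n) => //; exists B'.
rewrite measurable_prod_measurableType; apply: smallest_sub => // _ [A mA] [B mB] <-.
have -> : A `*` B = (A `*` setT) `&` (setT `*` B) by apply/seteqP; split => -[x y] /=; tauto.
exact: (@measurableI _ (g_sigma_algebraType G) _ _ (cyl1 _ mA) (cyl2 _ mB)).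
Qed.

End ProductGenerated.

Section ZeroIntegrals.
Local Open Scope ereal_scope.
Context d (T : measurableType d) {R : realType} (mu : {measure set T -> \bar R}).
Variables (G : set (set T)) (g : (set T)^nat).
Hypotheses (mG : @measurable _ T = <<s G>>) (setIG : setI_closed G).
Hypotheses (Gg : forall n, G (g n)) (cover : \bigcup_n g n = setT).

(** Inside one set of the cover, the positive and the negative part of [h] are
    densities of two finite measures that agree on [G], hence everywhere; so
    [h] has vanishing integral over every measurable subset. *)
Lemma ae_eq0_of_integrals (h : T -> \bar R) : measurable_fun setT h ->
  (forall A, G A -> mu.-integrable A h) ->
  (forall A, G A -> \int[mu]_(x in A) h x = 0) ->
  ae_eq mu setT h (cst 0).
Proof.
move=> mh ih h0.
have Gm A : G A -> measurable A by rewrite mG; exact: sub_sigma_algebra.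
suff aeK n : ae_eq mu (g n) h (cst 0).
  have := negligible_bigcup aeK.
  apply: negligibleS => x /= xN.
  have : (\bigcup_n g n) x by rewrite cover.
  by move=> [n _ gx]; exists n => //= hx; apply: xN => _; exact: hx.
pose K := g n; have mK : measurable K by exact/Gm/Gg.
have intK E (F : T -> \bar R) : \int[mu]_(x in E) (F \_ K) x = \int[mu]_(x in E `&` K) F x.
  by rewrite integral_mkcondr.
have mres (F : T -> \bar R) : measurable_fun setT F -> measurable_fun setT (F \_ K).
  by move=> mF; apply/(measurable_restrictT _ mK); exact: measurable_funTS.
have posK (F : T -> \bar R) : (forall x, 0 <= F x) -> forall x, 0 <= (F \_ K) x.
  by move=> F0 x; rewrite patchE; case: ifP.
have key (E : set T) : measurable E ->
    \int[mu]_(x in E) (h^\+ \_ K) x = \int[mu]_(x in E) (h^\- \_ K) x.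
  pose mp A := \int[mu]_(x in A) (h^\+ \_ K) x.
  pose mn A := \int[mu]_(x in A) (h^\- \_ K) x.
  have hp0 := posK _ (funepos_ge0 h); have hn0 := posK _ (funeneg_ge0 h).
  have mhp := mres _ (measurable_funepos mh); have mhn := mres _ (measurable_funeneg mh).
  pose mpM := isMeasure.Build _ _ _ mp (integral_set0 _ _)
    (fun A => integral_ge0 _ (fun x _ => hp0 x)) (semi_sigma_additive_nng_induced mhp hp0).
  pose mnM := isMeasure.Build _ _ _ mn (integral_set0 _ _)
    (fun A => integral_ge0 _ (fun x _ => hn0 x)) (semi_sigma_additive_nng_induced mhn hn0).
  pose MP : {measure set T -> \bar R} := HB.pack mp mpM.
  pose MN : {measure set T -> \bar R} := HB.pack mn mnM.
  move=> mE; apply: (measure_unique G g mG setIG Gg cover MP MN) => //.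
    move=> A GA; rewrite /= /mp /mn !intK.
    have GAK : G (A `&` K) by apply: setIG => //; exact: Gg.
    have := h0 _ GAK; rewrite integralE => /eqP; rewrite sube_eq.
    - by rewrite add0e => /eqP.
    - exact: (integrable_pos_fin_num (Gm _ GAK) (ih _ GAK)).
    - by rewrite fin_num_adde_defl// (integrable_neg_fin_num (Gm _ GAK) (ih _ GAK)).
  move=> k; rewrite /= /mp intK.
  have GAK : G (g k `&` K) by apply: setIG; exact: Gg.
  by rewrite ltey_eq (integrable_pos_fin_num (Gm _ GAK) (ih _ GAK)).
apply: integral_ae_eq => //; first exact: ih.
move=> E EK mE; rewrite integral0 integralE.
have := key _ mE; rewrite !intK (setIidl EK) => ->.
rewrite subee// integrable_neg_fin_num//.
exact: (integrableS mK mE EK (ih _ (Gg n))).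
Qed.

End ZeroIntegrals.

Section Boxes.
Context {R : realType}.

Let sym_itv (n : nat) : set R := `]- n%:R, n%:R[%classic.

Lemma bigcup_sym_itv : \bigcup_n sym_itv n = setT.
Proof.
exact: (bigcup_itvT false true).
Qed.

Definition boxes : set (set (R3 R)) := [set A | exists a b, A = box a b].

Definition sym_box (n : nat) : set (R3 R) :=
  box (- n%:R, - n%:R, - n%:R) (n%:R, n%:R, n%:R).

Lemma bigcup_sym_box : \bigcup_n sym_box n = setT.
Proof.
rewrite -subTset => x _; exists (Num.truncn (`|x.1.1| + `|x.1.2| + `|x.2|)).+1 => //.
have := Num.Theory.truncnS_gt (`|x.1.1| + `|x.1.2| + `|x.2|).
set n := _.+1%:R => xn.
have H y : `|y| <= `|x.1.1| + `|x.1.2| + `|x.2| -> `]- n, n[%classic y.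
  by move=> yx; rewrite /= in_itv/= -ltr_norml; exact: le_lt_trans xn.
by split; [split|]; apply: H; rewrite /= ?lerDr -?addrA ?lerDl ?addr_ge0// addrCA lerDl addr_ge0.
Qed.

Lemma setI_closed_boxes : setI_closed boxes.
Proof.
move=> _ _ [a [b ->]] [c [d ->]].
exists (Num.max a.1.1 c.1.1, Num.max a.1.2 c.1.2, Num.max a.2 c.2).
exists (Num.min b.1.1 d.1.1, Num.min b.1.2 d.1.2, Num.min b.2 d.2).
have itvI (x y z t : R) : `]x, y[ `&` `]z, t[ = `]Num.max x z, Num.min y t[%classic.
  apply/seteqP; split => u /=; rewrite !in_itv/= gt_max lt_min.
    by move=> [/andP[-> ->] /andP[-> ->]].
  by move=> /andP[/andP[-> ->] /andP[-> ->]].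
by rewrite /box -setXI -setXI !itvI.
Qed.

Lemma measurable_boxes : @measurable _ (R3 R) = <<s boxes>>.
Proof.
pose G1 : set (set (measurableTypeR R)) := @RGenOpens.G R.
have mR : ((R.-ocitv).-measurable).-sigma.-measurable = <<s G1>> by exact: RGenOpens.measurableE.
have g1 n : G1 (sym_itv n) by exists (- n%:R), n%:R.
have m2 := @measurable_prod_generated _ _ (measurableTypeR R) (measurableTypeR R)
  _ _ _ _ mR mR g1 g1 bigcup_sym_itv bigcup_sym_itv.
rewrite (@measurable_prod_generated _ _
  (measurableTypeR R * measurableTypeR R)%type (measurableTypeR R) _ _
  (fun n => sym_itv n `*` sym_itv n) _ m2 mR _ g1 _ bigcup_sym_itv).
- congr (<<s _ >>); apply/seteqP; split.
    move=> _ [_ [_ [a1 [b1 ->]] [_ [a2 [b2 ->]] <-]] [_ [a3 [b3 ->]] <-]].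
    by exists (a1, a2, a3), (b1, b2, b3).
  move=> _ [a [b ->]]; exists (`]a.1.1, b.1.1[ `*` `]a.1.2, b.1.2[).
    exists `]a.1.1, b.1.1[%classic; first by exists a.1.1, b.1.1.
    by exists `]a.1.2, b.1.2[%classic => //; exists a.1.2, b.1.2.
  by exists `]a.2, b.2[%classic => //; exists a.2, b.2.
- by move=> n; exists (sym_itv n) => //; exists (sym_itv n).
- rewrite -subTset => x _; exists (Num.truncn (`|x.1| + `|x.2|)).+1 => //.
  have := Num.Theory.truncnS_gt (`|x.1| + `|x.2|); rewrite /sym_itv.
  set n := _.+1%:R => xn.
  have H y : `|y| <= `|x.1| + `|x.2| -> `]- n, n[%classic y.
    by move=> yx; rewrite /= in_itv/= -ltr_norml; exact: le_lt_trans xn.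
  by split; apply: H; rewrite ?lerDl ?lerDr.
Qed.

Lemma leb3_box_lty (a b : R3 R) : (leb3 (box a b) < +oo)%E.
Proof.
have itv_lty (x y : R) : (@lebesgue_measure R `]x, y[%classic < +oo)%E.
  by rewrite lebesgue_measure_itv/=; case: ifP => // _; rewrite -EFinB ltry.
have E3 : (leb3 (box a b) = leb2 (`]a.1.1, b.1.1[ `*` `]a.1.2, b.1.2[) *
    @lebesgue_measure R `]a.2, b.2[%classic)%E.
  by apply: product_measure1E; [apply: measurableX|]; exact: measurable_itv.
have E2 : (leb2 (`]a.1.1, b.1.1[ `*` `]a.1.2, b.1.2[) =
    @lebesgue_measure R `]a.1.1, b.1.1[%classic *
    @lebesgue_measure R `]a.1.2, b.1.2[%classic)%E.
  by apply: product_measure1E; exact: measurable_itv.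
rewrite E3 E2; apply: lte_mul_pinfty => //; first by rewrite mule_ge0.
by rewrite fin_numM// ge0_fin_numE.
Qed.

End Boxes.

Section Continuous.
Context {R : realType}.

(** An open set is the union of the rational boxes that it contains.  This
    relates the product topology to the product sigma-algebra. *)
Lemma measurable_open_R3 (U : set (R3 R)) : open U -> measurable U.
Proof.
move=> oU.
pose Q := (rat * rat * rat)%type.
pose emb (q : Q) : R3 R := (ratr q.1.1, ratr q.1.2, ratr q.2).
pose B (q : Q * Q) := box (emb q.1) (emb q.2).
have -> : U = \bigcup_(q in [set q | B q `<=` U]) B q.
  apply/seteqP; split => [x Ux|x [q /= ]]; last exact.
  have : nbhs x U by exact: open_nbhs_nbhs.
  move=> /nbhs_ballP[e /= e0 xe].
  have lo (y : R) : exists q : rat, y - e < ratr q < y.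
    by have [q] := @rat_in_itvoo R (y - e) y
      (ltac:(by rewrite ltrBlDr ltrDl)); rewrite in_itv; exists q.
  have hi (y : R) : exists q : rat, y < ratr q < y + e.
    by have [q] := @rat_in_itvoo R y (y + e)
      (ltac:(by rewrite ltrDl)); rewrite in_itv; exists q.
  have [a1 /andP[l1 r1]] := lo x.1.1; have [a2 /andP[l2 r2]] := lo x.1.2.
  have [a3 /andP[l3 r3]] := lo x.2.
  have [b1 /andP[m1 s1]] := hi x.1.1; have [b2 /andP[m2 s2]] := hi x.1.2.
  have [b3 /andP[m3 s3]] := hi x.2.
  exists ((a1, a2, a3), (b1, b2, b3)); last first.
    by rewrite /B /box /= !in_itv/= r1 r2 r3 m1 m2 m3.
  have near (y z a b : R) : y - e < a -> b < y + e -> a < z < b -> ball y e z.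
    by move=> ya yb /andP[az zb]; rewrite /ball/= distrC ltr_distl (lt_trans ya)//= (lt_trans zb).
  move=> y /=; rewrite /B /box /= !in_itv/= => -[[y1 y2] y3]; apply: xe.
  by split; [split|]; [exact: near y1|exact: near y2|exact: near y3].
rewrite bigcup_mkcond; apply: countable_bigcupT_measurable => [|q].
  exact: countableP.
by case: ifP => // _; exact: measurable_box.
Qed.

Lemma measurable_continuous_R3 (f : R3 R -> R) : continuous f -> measurable_fun setT f.
Proof.
move=> /continuousP cf; apply: (measurability _ (RGenOpens.measurableE R)).
move=> _ [_ [a [b ->] <-]]; rewrite setTI; apply: measurable_open_R3.
exact/cf/interval_open.
Qed.

End Continuous.

(** * Weak gradients are unique almost everywhere *)

Section BoxIntegrals.
Local Open Scope ereal_scope.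
Context {R : realType}.

Lemma measurable_Lfun2 (f : R3 R -> R) : f \in Lfun leb3 2%:E -> measurable_fun setT f.
Proof. by move=> /sub_Lfun_mfun; rewrite inE. Qed.

(** On a set of finite measure, [`|f| <= 1 + f ^ 2] suffices. *)
Lemma Lfun2_integrable_box (f : R3 R -> R) (a b : R3 R) :
  f \in Lfun leb3 2%:E -> leb3.-integrable (box a b) (EFin \o f).
Proof.
move=> f2; have mf := measurable_Lfun2 f2.
have mB := measurable_box a b.
have i2 : leb3.-integrable (box a b) (fun x => (`|f x| `^ 2)%:E).
  by apply: (integrableS measurableT mB) => //; apply: Lfun_integrable => //; rewrite ler1n.
have i1 : leb3.-integrable (box a b) (EFin \o cst 1%R).
  apply/integrableP; split; first exact/measurable_EFinP.
  rewrite (eq_integral (cst 1%E)); last by move=> x _ /=; rewrite normr1.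
  by rewrite integral_cst// mul1e; exact: leb3_box_lty.
apply: le_integrable (integrableD mB i1 i2) => //.
  by apply/measurable_EFinP; exact: measurable_funTS.
move=> x _ /=; rewrite lee_fin [leRHS]ger0_norm ?addr_ge0 ?powR_ge0//.
have [h|h] := leP `|f x|%R 1%R; first by apply: (le_trans h); rewrite lerDl powR_ge0.
rewrite powR_mulrn// expr2; apply: (@le_trans _ _ (`|f x| * `|f x|)%R); last by rewrite lerDr.
by rewrite ler_peMl// ltW.
Qed.

(** Dominated convergence: the bumps are at most 1 and vanish off the box. *)
Lemma cvg_integral_bump (f : R3 R -> R) (a b : R3 R) :
  f \in Lfun leb3 2%:E ->
  \int[leb3]_x (f x * bump a b n x)%:E @[n --> \oo] --> \int[leb3]_(x in box a b) (f x)%:E.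
Proof.
move=> f2; have mf := measurable_Lfun2 f2.
have mB := measurable_box a b.
have mF : measurable_fun setT ((EFin \o f) \_ (box a b)).
  by apply/(measurable_restrictT _ mB)/measurable_EFinP; exact: measurable_funTS.
have [] := @dominated_convergence _ _ _ (@leb3 R) setT measurableT
  (fun n x => (f x * bump a b n x)%:E) ((EFin \o f) \_ (box a b))
  (abse \o ((EFin \o f) \_ (box a b))).
- move=> n; apply/measurable_EFinP/measurable_funM => //.
  apply: measurable_continuous_R3.
  by have [/(_ 0%N)] := test_function_bump a b n.
- exact: mF.
- apply: aeW => x _ /=; rewrite patchE; case: ifPn => [/set_mem xB|/negP xB].
    apply/fine_cvgP; split; first exact: nearW.
    rewrite /= -[X in _ --> X]mulr1; apply: cvgM; first exact: cvg_cst.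
    exact: cvg_bump.
  have x0 n : bump a b n x = 0%R by apply: bump_eq0 => xB'; apply: xB; exact/mem_set.
  by apply: cvg_near_cst; apply: nearW => n; rewrite x0 mulr0.
- apply/integrable_abse/(integrable_restrict _ mB); rewrite ?setTI//.
  exact: Lfun2_integrable_box.
- apply: aeW => x n _ /=; rewrite patchE; case: ifPn => [_|/negP xB].
    rewrite /= lee_fin normrM ler_piMr// ger0_norm ?bump_ge0//.
    exact: bump_le1.
  have x0 : bump a b n x = 0%R by apply: bump_eq0 => xB'; apply: xB; exact/mem_set.
  by rewrite x0 mulr0 /= normr0.
by move=> _ _; rewrite [in X in _ -> X]integral_mkcond.
Qed.

End BoxIntegrals.

Lemma Lnorm_eq_integral d (T : measurableType d) (R : realType)
    (mu : {measure set T -> \bar R}) (p : R) (f g : T -> \bar R) :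
  (\int[mu]_x (`|f x| `^ p) = \int[mu]_x (`|g x| `^ p))%E ->
  ('N[mu]_p%:E[f] = 'N[mu]_p%:E[g])%E.
Proof. by move=> fg; rewrite unlock /Lnorm fg. Qed.

Section WeakGradient.
Local Open Scope ereal_scope.
Context {R : realType}.
Implicit Types (phi psi : R3 R -> R) (g : R3 R -> R3 R).

(** Testing against bumps shows that the two functions have the same integral
    over every box. *)
Lemma weak_gradient_ae_unique phi g g' (i : 'I_3) :
  L2_weak_gradient phi g -> L2_weak_gradient phi g' ->
  ae_eq leb3 setT (coord i \o g) (coord i \o g').
Proof.
move=> [g2 gE] [g'2 g'E].
have mg := measurable_Lfun2 (g2 i); have mg' := measurable_Lfun2 (g'2 i).
have box_eq a b : \int[leb3]_(x in box a b) (coord i (g x))%:E =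
    \int[leb3]_(x in box a b) (coord i (g' x))%:E.
  have c1 := cvg_integral_bump (a := a) (b := b) (g2 i).
  have c2 := cvg_integral_bump (a := a) (b := b) (g'2 i).
  apply: cvg_unique c1 _ => //.
  rewrite (_ : (fun n => _) = (fun n => \int[leb3]_x (coord i (g' x) * bump a b n x)%:E));
    first exact: c2.
  apply/funext => n; apply: oppe_inj; rewrite -gE ?g'E//; exact: test_function_bump.
have ii a b := Lfun2_integrable_box a b (g2 i).
have ii' a b := Lfun2_integrable_box a b (g'2 i).
have := @ae_eq0_of_integrals _ _ R leb3 boxes (@sym_box R) measurable_boxes
  setI_closed_boxes _ bigcup_sym_box ((EFin \o (coord i \o g)) \- (EFin \o (coord i \o g'))).
case.
- by move=> n; exists (- n%:R, - n%:R, - n%:R)%R, (n%:R, n%:R, n%:R)%R.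
- by apply: emeasurable_funB; apply/measurable_EFinP.
- by move=> _ [a [b ->]]; apply: integrableB => //; exact: measurable_box.
- move=> _ [a [b ->]]; rewrite integralB//; last exact: measurable_box.
  rewrite [X in X - _]box_eq subee//.
  exact: (integrable_fin_num (measurable_box a b) (ii' a b)).
move=> N [mN N0 sub]; exists N; split => // x /= H; apply: sub => /= H'.
apply: H => _; have := H' I; rewrite /= => -[] /eqP; rewrite subr_eq0 => /eqP.
by [].
Qed.

Lemma measurable_enorm g : (forall i, measurable_fun setT (coord i \o g)) ->
  measurable_fun setT (enorm \o g).
Proof.
move=> mg; apply: (measurableT_comp (f := @Num.sqrt R)).
  by apply: continuous_measurable_fun; exact: sqrt_continuous.
apply: measurable_sum => i; apply: measurable_funX; exact: mg.
Qed.

(** This makes the energy independent of the weak gradient that [grad]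
    selects. *)
Lemma Lnorm2_enorm_weak_gradient phi g g' :
  L2_weak_gradient phi g -> L2_weak_gradient phi g' ->
  'N[leb3]_2%:E[EFin \o enorm \o g] = 'N[leb3]_2%:E[EFin \o enorm \o g'].
Proof.
move=> Hg Hg'.
have mN (h : R3 R -> R3 R) : L2_weak_gradient phi h ->
    measurable_fun setT (fun x => `|(EFin \o enorm \o h) x| `^ 2).
  move=> [h2 _]; apply: (measurableT_comp (measurable_poweR 2)).
  apply: measurableT_comp => //; apply/measurable_EFinP; apply: measurable_enorm => i.
  exact: measurable_Lfun2.
apply: Lnorm_eq_integral.
apply: (ge0_ae_eq_integral measurableT (mN _ Hg) (mN _ Hg')).
- by move=> x _; exact: poweR_ge0.
- by move=> x _; exact: poweR_ge0.
have H i := weak_gradient_ae_unique i Hg Hg'.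
have := H ord0; have := H (lift ord0 ord0); have := H (lift ord0 (lift ord0 ord0)).
apply: filterS3 => x /(_ I) e2 /(_ I) e1 /(_ I) e0 _ /=.
congr (`| _%:E | `^ _); congr Num.sqrt; rewrite !big_ord_recl !big_ord0.
by congr (_ ^+ 2 + (_ ^+ 2 + (_ ^+ 2 + _)))%R.
Qed.

Lemma weak_gradient_grad phi : H1 phi -> L2_weak_gradient phi (grad phi).
Proof. by move=> [_ [g Hg]]; rewrite /grad; case: xgetP => [? -> //|/(_ g)]. Qed.

End WeakGradient.

(** * The energy under rescaling *)

Section Scaling.
Local Open Scope ereal_scope.
Context {R : realType}.
Implicit Types (phi psi : R3 R -> R) (g : R3 R -> R3 R).

Definition rescale (s l : R) phi : R3 R -> R := fun x => (s * phi (l *: x))%R.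

Lemma measurable_rescale s l phi :
  measurable_fun setT phi -> measurable_fun setT (rescale s l phi).
Proof.
move=> mphi; apply: measurable_funM; first exact: measurable_cst.
exact: measurableT_comp mphi (measurable_dilation l).
Qed.

Lemma Lnorm_rescale (p s l : R) phi :
  p != 0%R -> (0 < l)%R -> measurable_fun setT phi ->
  'N[leb3]_p%:E[EFin \o rescale s l phi] `^ p =
  (`|s| `^ p * l ^- 3)%:E * 'N[leb3]_p%:E[EFin \o phi] `^ p.
Proof.
move=> p0 l0 mphi; rewrite !poweR_Lnorm//.
have mF : measurable_fun setT (fun x => `|(EFin \o phi) x| `^ p).
  apply: (measurableT_comp (measurable_poweR p)).
  by apply: measurableT_comp => //; exact/measurable_EFinP.
have F0 x : 0 <= `|(EFin \o phi) x| `^ p by exact: poweR_ge0.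
rewrite EFinM -muleA -(ge0_integral_dilation l0 mF F0).
rewrite -ge0_integralZl//.
- by apply: eq_integral => x _; rewrite /rescale /= normrM powRM.
- exact: (measurableT_comp mF (measurable_dilation l)). 
Qed.

Lemma Lfun_rescale (p s l : R) phi : p != 0%R -> (0 < l)%R ->
  phi \in Lfun leb3 p%:E -> rescale s l phi \in Lfun leb3 p%:E.
Proof.
move=> p0 l0 /andP[]; rewrite !inE/= => mphi fphi.
apply/andP; split; rewrite inE/=; first exact: measurable_rescale.
apply: (lty_poweRy p0); rewrite Lnorm_rescale//.
apply: lte_mul_pinfty => //; last exact: poweR_lty.
by rewrite lee_fin mulr_ge0 ?powR_ge0// invr_ge0 exprn_ge0// ltW.
Qed.

Lemma test_function_rescale s l psi : l != 0%R ->
  test_function psi -> test_function (rescale s l psi).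
Proof.
move=> l0 [Cpsi cpsi]; split=> [k|]; first exact: Ck_scaled_dilation.
pose f (x : R3 R) : R3 R := (l^-1 *: x)%R.
have cf : continuous f by exact: scaler_continuous.
have cK : compact (f @` closure [set x | psi x != 0%R]).
  by apply: continuous_compact => //; exact: continuous_subspaceT.
apply: (subclosed_compact _ cK); first exact: closed_closure.
have -> : f @` closure [set x | psi x != 0%R] = closure (f @` closure [set x | psi x != 0%R]).
  by apply/closure_id; apply: compact_closed => //; exact: norm_hausdorff.
apply: closureS => x /=; rewrite /rescale mulf_eq0 negb_or => /andP[_ psix].
exists (l *: x)%R; first exact: subset_closure.
by rewrite /f scalerA mulVf// scale1r.
Qed.

(** Changing variables turns [psi] into the test function
    [y |-> s * l * psi (l^-1 * y)]; with this constant inside the test function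
    no factor has to be pulled out of an integral that might diverge. *)
Lemma weak_gradient_rescale s l phi g : (0 < l)%R -> measurable_fun setT phi ->
  L2_weak_gradient phi g ->
  L2_weak_gradient (rescale s l phi) (fun x => ((s * l) *: g (l *: x) : R3 R)%R).
Proof.
move=> l0 mphi [g2 gE]; have ln0 : l != 0%R by rewrite gt_eqF.
have coordZ (i : 'I_3) c (x : R3 R) : coord i (c *: x : R3 R)%R = (c * coord i x)%R.
  by case: i => -[|[|[|]]].
split=> [i|psi tpsi i].
  rewrite (_ : _ \o _ = rescale (s * l) l (coord i \o g)); last first.
    by apply/funext => x; rewrite /= coordZ.
  by apply: Lfun_rescale => //; rewrite pnatr_eq0.
pose eta := rescale (s * l) l^-1 psi.
have teta : test_function eta by apply: test_function_rescale; rewrite ?invr_eq0.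
have [Cpsi _] := tpsi; have [_ /(_ i)[dpsi Cdpsi]] := Cpsi 1%N.
have [Ceta _] := teta; have [_ /(_ i)[_ Cdeta]] := Ceta 1%N.
have mg := measurable_Lfun2 (g2 i).
have Deta x : 'D_(unit_vec i) eta (l *: x : R3 R)%R = (s * 'D_(unit_vec i) psi x)%R.
  have xE : (l^-1 *: (l *: x : R3 R) : R3 R)%R = x by rewrite scalerA mulVf// scale1r.
  have [_ ->] := @derive_scaled_dilation R psi (s * l) l^-1 (l *: x : R3 R)%R (unit_vec i)
    (dpsi _).
  by rewrite xE mulfK.
pose F (y : R3 R) := (phi y * 'D_(unit_vec i) eta y)%:E.
pose G (y : R3 R) := (coord i (g y) * eta y)%:E.
have mF : measurable_fun setT F.
  apply/measurable_EFinP/measurable_funM => //.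
  exact: measurable_continuous_R3.
have mG : measurable_fun setT G.
  apply/measurable_EFinP/measurable_funM => //.
  by apply: measurable_continuous_R3; have [/(_ 0%N)] := teta.
transitivity (\int[leb3]_x F (l *: x)%R).
  by apply: eq_integral => x _; rewrite /F Deta /rescale mulrCA mulrA.
transitivity (- \int[leb3]_x G (l *: x)%R); last first.
  congr (- _); apply: eq_integral => x _.
  rewrite /G /eta /rescale scalerA mulVf// scale1r coordZ.
  by rewrite mulrCA mulrA.
by rewrite (integral_dilation l0 mF) (integral_dilation l0 mG) /F gE// muleN.
Qed.

Lemma enormZ (c : R) (x : R3 R) : enorm (c *: x : R3 R)%R = (`|c| * enorm x)%R.
Proof.
rewrite -sqrtr_sqr -sqrtrM ?sqr_ge0// mulr_sumr; congr Num.sqrt.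
by apply: eq_bigr => -[[|[|[|]]]] //= i _; rewrite /coord/= exprMn.
Qed.

Lemma H1_rescale s l phi : (0 < l)%R -> H1 phi -> H1 (rescale s l phi).
Proof.
move=> l0 [phi2 [g gE]]; split; first by apply: Lfun_rescale => //; rewrite pnatr_eq0.
exists (fun x => ((s * l) *: g (l *: x) : R3 R)%R).
by apply: weak_gradient_rescale => //; exact: measurable_Lfun2.
Qed.

Lemma poweR2 (x : \bar R) : 0 <= x -> x `^ 2 = x ^+ 2.
Proof.
move=> x0; have -> : (2 = 1 + 1 :> R)%R by [].
rewrite poweRD ?poweRe1// ?expe2//; apply: add_neq0_poweRD_def.
by rewrite gt_eqF.
Qed.

(** The squared gradient norm is multiplied by [(s * l) ^ 2 / l ^ 3 = l ^ 2] and
    the L^1 norm by [s / l ^ 3]; the coefficient [b * s * l ^ 2] is the one for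
    which the second term is multiplied by [l ^ 2] as well. *)
Lemma energy_rescale (b s l : R) phi :
  (0 <= b)%R -> (0 < l)%R -> (0 <= s)%R -> (s ^+ 2 = l ^+ 3)%R ->
  H1 phi ->
  energy (b * (s * l ^+ 2))%R (rescale s l phi) = (l ^+ 2)%:E * energy b phi.
Proof.
move=> b0 l0 s0 sl Hphi.
have l2 : phi \in Lfun leb3 2%:E by have [] := Hphi.
have mphi := measurable_Lfun2 l2.
have gphi := weak_gradient_grad Hphi.
have gs := weak_gradient_rescale s l0 mphi gphi.
have two0 : (2%R : R) != 0%R by rewrite pnatr_eq0.
have ln0 : l != 0%R by rewrite gt_eqF.
have menorm : measurable_fun setT (enorm \o grad phi).
  by apply: measurable_enorm => i; have [/(_ i) gi _] := gphi; exact: measurable_Lfun2.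
rewrite /energy (Lnorm2_enorm_weak_gradient (weak_gradient_grad (H1_rescale s l0 Hphi)) gs).
rewrite -!poweR2 ?Lnorm_ge0//.
have -> : EFin \o enorm \o (fun x => ((s * l) *: grad phi (l *: x) : R3 R)%R) =
    EFin \o rescale (s * l) l (enorm \o grad phi).
  apply/funext => x; rewrite /rescale /= enormZ ger0_norm//.
  by rewrite mulr_ge0// ltW.
rewrite Lnorm_rescale//.
have N1 := @Lnorm_rescale 1 s l phi (oner_neq0 _) l0 mphi.
rewrite !poweRe1 ?Lnorm_ge0// in N1; rewrite N1.
rewrite powRr1 ?normr_ge0// !ger0_norm ?mulr_ge0// ?(ltW l0)//.
rewrite powR_mulrn ?mulr_ge0 ?(ltW l0)//.
have -> : ((s * l) ^+ 2 * l ^- 3 = l ^+ 2)%R.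
  by rewrite exprMn sl mulrAC mulfV ?mul1r// expf_neq0.
rewrite ge0_muleDr; last 2 first.
- by rewrite mule_ge0// poweR_ge0.
- by rewrite mule_ge0// Lnorm_ge0.
congr (_ + _); first by rewrite muleCA.
rewrite !muleA -!EFinM; congr (_%:E * _).
have -> : (b * (s * l ^+ 2) * (s * l ^- 3) = l ^+ 2 * b * (s ^+ 2 / l ^+ 3))%R by ring.
by rewrite sl mulfV ?mulr1// expf_neq0.
Qed.

End Scaling.

Section EnergyBounds.
Local Open Scope ereal_scope.
Context {R : realType}.
Implicit Types (phi psi : R3 R -> R) (g : R3 R -> R3 R).

Lemma Lnorm2_enorm_lty phi g : L2_weak_gradient phi g ->
  'N[leb3]_2%:E[EFin \o enorm \o g] < +oo.
Proof.
move=> [g2 _]; have two0 : (2%R : R) != 0%R by rewrite pnatr_eq0.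
apply: (@lty_poweRy _ _ 2) => //; rewrite poweR_Lnorm//.
have two1 : (1 <= 2%R :> R)%R by rewrite ler1n.
pose i2 (i : 'I_3) := Lfun_integrable two1 (g2 i).
have := integrableD measurableT (integrableD measurableT (i2 ord0) (i2 (lift ord0 ord0)))
  (i2 (lift ord0 (lift ord0 ord0))).
move=> /(integrable_lty measurableT); apply: le_lt_trans.
rewrite le_eqVlt; apply/orP; left; apply/eqP.
apply: eq_integral => x _ /=.
rewrite !powR_mulrn// -!EFinD; congr _%:E.
rewrite ger0_norm ?sqrtr_ge0// sqr_sqrtr ?sumr_ge0//; last by move=> i _; exact: sqr_ge0.
by rewrite !big_ord_recl big_ord0 addr0 addrA !real_normK ?num_real.
Qed.

(** A function of vanishing L^1 norm is null, hence has L^2 norm 0, not 1. *)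
Lemma admissible_Lnorm1_gt0 phi : admissible phi -> 0 < 'N[leb3]_1[EFin \o phi].
Proof.
move=> [Hphi _ N2]; rewrite lt_neqAle Lnorm_ge0 andbT eq_sym.
have mphi : measurable_fun setT (EFin \o phi).
  by apply/measurable_EFinP; have [/measurable_Lfun2] := Hphi.
apply/eqP => N1; have := Lnorm_eq0_eq0 mphi lte01 N1 => phi0.
suff : 'N[leb3]_2%:E[EFin \o phi] = 0 by rewrite N2 => /eqP; rewrite onee_eq0.
have two0 : (2%R : R)%:E != 0 by rewrite eqe pnatr_eq0.
rewrite -(Lnorm0 leb3 two0); apply: Lnorm_eq_integral.
have mN (f : R3 R -> \bar R) : measurable_fun setT f -> measurable_fun setT (fun x => `|f x| `^ 2).
  by move=> mf; apply: (measurableT_comp (measurable_poweR 2)); exact: measurableT_comp.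
apply: (ge0_ae_eq_integral measurableT (mN _ mphi) (mN _ (measurable_cst _))).
- by move=> x _; exact: poweR_ge0.
- by move=> x _; exact: poweR_ge0.
by apply: filterS phi0 => x /(_ I) e _; rewrite e.
Qed.

Lemma energy_fin_pos b phi : (0 < b)%R -> admissible phi ->
  exists2 F : R, (0 < F)%R & energy b phi = F%:E.
Proof.
move=> b0 aphi; have [Hphi phi1 _] := aphi.
have N1 := admissible_Lnorm1_gt0 aphi.
have Nfin : 'N[leb3]_1[EFin \o phi] \is a fin_num.
  by rewrite ge0_fin_numE ?Lnorm_ge0//; have /andP[_] := phi1; rewrite inE.
have Gfin : 'N[leb3]_2%:E[EFin \o enorm \o grad phi] \is a fin_num.
  by rewrite ge0_fin_numE ?Lnorm_ge0//; exact: Lnorm2_enorm_lty (weak_gradient_grad Hphi).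
have Efin : energy b phi \is a fin_num.
  by rewrite /energy fin_numD !fin_numM ?fin_numX.
exists (fine (energy b phi)); last by rewrite fineK.
rewrite -lte_fin fineK// /energy; apply: lt_le_trans (leeDr _ _).
  by rewrite mule_gt0.
by rewrite mule_ge0// expe_ge0 ?Lnorm_ge0.
Qed.

End EnergyBounds.

(** * The first touching point of the profile *)

Section Sinc.
Context {R : realType}.

Lemma sinc_is_derive (x : R) : 0 < x ->
  is_derive x 1 (@sinc R) ((x * cos x - sin x) / x ^+ 2).
Proof.
move=> x0; have xn0 : x != 0 by rewrite gt_eqF.
apply: (@near_eq_is_derive _ _ _ (sin * (fun y => y^-1)) _).
  near=> y; rewrite /sinc ifF//.
  apply/negbTE; rewrite gt_eqF//; near: y; exact: lt_nbhsr.
have Dinv : is_derive x 1 (@GRing.inv R) (- x ^- 2).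
  by have := @is_deriveV R id x 1 1 xn0 _; rewrite /GRing.scale/= mulr1; apply.
apply: is_derive_eq; rewrite /GRing.scale/=.
by field.
Unshelve. all: by end_near.
Qed.

Lemma sinc_continuous_pos (x : R) : 0 < x -> {for x, continuous (@sinc R)}.
Proof.
move=> x0; apply/differentiable_continuous/derivable1_diffP.
by have [] := sinc_is_derive x0.
Qed.

(** The profile agrees with its analytic formula only on the left of [rad];
    the left difference quotients already determine the derivative. *)
Lemma is_derive_left_eq (f p : R -> R) (x d d' : R) :
  (forall y, y <= x -> f y = p y) -> is_derive x 1 f d -> is_derive x 1 p d' -> d = d'.
Proof.
move=> fp [df Df] [dp Dp].
have cf : h^-1 *: ((f \o shift x) (h *: 1) - f x) @[h --> 0^'-] --> (d : R).
  by apply: cvg_dnbhs_at_left; rewrite -Df; exact: df.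
have cp : h^-1 *: ((p \o shift x) (h *: 1) - p x) @[h --> 0^'-] --> (d' : R).
  by apply: cvg_dnbhs_at_left; rewrite -Dp; exact: dp.
suff cp' : h^-1 *: ((f \o shift x) (h *: 1) - f x) @[h --> 0^'-] --> (d' : R).
  by apply: cvg_unique cf cp' => //; exact: norm_hausdorff.
apply: cvg_trans cp.
apply: near_eq_cvg; near=> h.
have h0 : h < 0 by near: h; exact: nbhs_left_lt.
by rewrite /= !fp//= /GRing.scale/= mulr1 gerDr ltW.
Unshelve. all: by end_near.
Qed.

(** The conditions on [t = mu * rad] that come from a profile which first
    vanishes, tangentially, at [rad]; they involve none of the parameters. *)
Definition sinc_level (t : R) :=
  [/\ 0 < t, sin t = t * cos t, cos t < 0 &
      forall x, 0 < x -> x < t -> sinc x != sinc t].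

Lemma sinc_critical (t : R) : 0 < t -> sin t = t * cos t -> sinc t = cos t.
Proof. by move=> t0 st; rewrite /sinc gt_eqF// st mulrAC mulfV ?mul1r// gt_eqF. Qed.

Lemma sqr_cos_critical (t : R) : sin t = t * cos t -> cos t ^+ 2 = (1 + t ^+ 2)^-1.
Proof.
move=> st; have t1 : 1 + t ^+ 2 != 0 by rewrite gt_eqF// ltr_pwDl// sqr_ge0.
apply: (mulIf t1); rewrite mulVf// mulrDr mulr1 -exprMn (mulrC (cos t)) -st.
exact: cos2Dsin2.
Qed.

(** If [t < t'], then [sinc t < sinc t' < 0 < sinc 1], so [sinc] takes the value
    [sinc t'] on [1, t], before [t']. *)
Lemma sinc_level_le (t t' : R) : sinc_level t -> sinc_level t' -> t' <= t.
Proof.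
move=> [t0 st ct _] [t'0 st' ct' lev]; rewrite leNgt; apply/negP => tt'.
have cc : cos t < cos t'.
  rewrite -ltrN2 -(ltr_pXn2r (n := 2)) ?nnegrE ?oppr_ge0 ?ltW// !sqrrN.
  have pos (x : R) : 0 < 1 + x ^+ 2 by rewrite ltr_pwDl ?sqr_ge0.
  rewrite !sqr_cos_critical// ltf_pV2 ?posrE//.
  by rewrite ltrD2l ltr_pXn2r ?nnegrE ?ltW.
have t1 : 1 < t.
  rewrite ltNge; apply/negP => t1; have := @sin_gt0_pi R t.
  rewrite t0 (le_lt_trans t1) ?(lt_le_trans _ (pi_ge2 R)) ?ltr1n// => /(_ isT).
  by rewrite st pmulr_rgt0// ltNge ltW.
have s1 : 0 < @sinc R 1.
  by rewrite /sinc oner_eq0 divr1; apply: sin_gt0_pi;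
    rewrite ltr01 (lt_le_trans _ (pi_ge2 R)) ?ltr1n.
have [] := @IVT R sinc 1 t (cos t') (ltW t1).
- apply: continuous_in_subspaceT => x; rewrite inE/= in_itv/= => /andP[x1 _].
  exact/sinc_continuous_pos/(lt_le_trans _ x1).
- by rewrite ge_min le_max (sinc_critical t0 st) (ltW cc) orbT/= (ltW (lt_trans ct' s1)).
move=> x; rewrite in_itv/= => /andP[x1 xt] sx.
have := lev x (lt_le_trans ltr01 x1) (le_lt_trans xt tt').
by rewrite (sinc_critical t'0 st') sx eqxx.
Qed.

Lemma profile_sinc_level (b a mu rad : R) :
  0 < b -> 0 < a -> 0 < mu ->
  first_zero (profile b a mu rad) rad -> is_derive rad 1 (profile b a mu rad) 0 ->
  sinc_level (mu * rad) /\ a * cos (mu * rad) + b / mu ^+ 2 = 0.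
Proof.
move=> b0 a0 mu0 [rad0 frad fmin] df; set t := mu * rad.
have t0 : 0 < t by rewrite mulr_gt0.
have tn0 : t != 0 by rewrite gt_eqF.
have Dt : is_derive (mu * rad) 1 (@sinc R) ((t * cos t - sin t) / t ^+ 2) by exact: sinc_is_derive.
have Dmu : is_derive rad 1 ( *%R mu) mu.
  by apply: is_derive_eq; rewrite /GRing.scale/= mulr1.
have Dp : is_derive rad 1 (fun r => a * sinc (mu * r) + b / mu ^+ 2)
    (a * (((t * cos t - sin t) / t ^+ 2) * mu) + 0).
  by apply: is_deriveD; apply: is_deriveZ; exact: is_derive1_comp.
have fp y : y <= rad -> profile b a mu rad y = a * sinc (mu * y) + b / mu ^+ 2.
  by rewrite /profile => ->.
have := is_derive_left_eq fp df Dp; rewrite addr0 => /esym/eqP.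
rewrite !mulf_eq0 invr_eq0 sqrf_eq0 (gt_eqF a0) (gt_eqF mu0) (gt_eqF t0) !orbF/= subr_eq0.
move=> /eqP/esym st.
have tE : a * cos t + b / mu ^+ 2 = 0 by rewrite -(sinc_critical t0 st) -fp.
have bm : 0 < b / mu ^+ 2 by rewrite divr_gt0// exprn_gt0.
split => //; split => //.
  move/eqP: tE; rewrite addr_eq0 => /eqP tE.
  by rewrite -(pmulr_rlt0 _ a0) tE oppr_lt0.
move=> x x0 xt; apply/eqP => sx.
have xr : x / mu < rad by rewrite ltr_pdivrMr// mulrC.
have : rad <= x / mu.
  apply: fmin; first by rewrite divr_gt0.
  rewrite fp ?ltW// (mulrC mu) mulfVK ?gt_eqF// sx -/t -frad fp//.
by rewrite leNgt xr.
Qed.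

End Sinc.

(** * Scaling laws *)

Section ScalingLaws.
Context {R : realType}.

Lemma Fmin_minimizer (b : R) phi : minimizer b phi -> Fmin b = energy b phi.
Proof.
move=> [aphi mphi]; apply/eqP; rewrite eq_le; apply/andP; split.
  by apply: ereal_inf_lbound; exists phi.
by apply: le_ereal_inf_tmp => _ [psi apsi <-]; exact: mphi.
Qed.

(** Eliminating [s] gives [b ^ 2 = l ^ 7]. *)
Lemma scale_exponents (b l s : R) :
  0 < b -> 0 < l -> s = b / l ^+ 2 -> s ^+ 2 = l ^+ 3 ->
  [/\ l = b `^ (2 / 7), s = b `^ (3 / 7) & l ^+ 2 = b `^ (4 / 7)].
Proof.
move=> b0 l0 sE sl; have ln0 : l != 0 by rewrite gt_eqF.
have b2 : b ^+ 2 = l ^+ 7.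
  have -> : b = s * l ^+ 2 by rewrite sE mulfVK// expf_neq0.
  by rewrite exprMn sl -exprM -exprD.
have lE : l = b `^ (2 / 7).
  rewrite powRrM (_ : b `^ 2 = b ^+ 2) ?powR_mulrn ?ltW// b2 -powR_mulrn ?ltW//.
  by rewrite -powRrM mulfV ?powRr1 ?ltW// pnatr_eq0.
have l2E : l ^+ 2 = b `^ (4 / 7).
  rewrite lE -powR_mulrn ?powR_ge0// -powRrM; by rewrite mulrAC -natrM.
have p0 : b `^ (4 / 7) != 0 by rewrite gt_eqF// powR_gt0.
split => //; rewrite sE l2E; apply: (mulIf p0).
rewrite /= mulfVK// -powRD; last by rewrite (gt_eqF b0) implybT.
by rewrite -mulrDl -natrD mulfV ?pnatr_eq0// powRr1// ltW.
Qed.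

(** Since [mu * rad] does not depend on [b], the vanishing of the profile at
    [rad] makes [a] proportional to [b / mu ^ 2]. *)
Lemma profile_rescale (b b1 a a1 mu mu1 rad rad1 : R) :
  0 < b -> 0 < b1 ->
  minimizer_parameters b a mu rad -> minimizer_parameters b1 a1 mu1 rad1 ->
  [/\ 0 < mu / mu1, a = b / b1 / (mu / mu1) ^+ 2 * a1, rad = (mu / mu1)^-1 * rad1 &
   profile b a mu rad \o enorm =
   rescale (b / b1 / (mu / mu1) ^+ 2) (mu / mu1) (profile b1 a1 mu1 rad1 \o enorm)].
Proof.
move=> b0 b10 [a0 mu0 z0 d0 _] [a10 mu10 z10 d10 _].
have [lev tE] := profile_sinc_level b0 a0 mu0 z0 d0.
have [lev1 tE1] := profile_sinc_level b10 a10 mu10 z10 d10.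
have tt : mu * rad = mu1 * rad1.
  by apply/le_anti; rewrite (sinc_level_le lev lev1) (sinc_level_le lev1 lev).
have mun0 : mu != 0 by rewrite gt_eqF.
have mu1n0 : mu1 != 0 by rewrite gt_eqF.
have b1n0 : b1 != 0 by rewrite gt_eqF.
have l0 : 0 < mu / mu1 by rewrite divr_gt0.
have radE : rad = (mu / mu1)^-1 * rad1.
  by rewrite invf_div mulrAC -tt mulrC mulrA mulVf// mul1r.
have [_ _ ct _] := lev1.
have aE : a = b / b1 / (mu / mu1) ^+ 2 * a1.
  move: tE tE1; rewrite tt; set c := cos _ in ct * => tE tE1.
  have cn0 : c != 0 by rewrite lt_eqF.
  apply: (mulIf cn0); apply/eqP; rewrite -subr_eq0.
  have -> : a * c - b / b1 / (mu / mu1) ^+ 2 * a1 * c =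
    (a * c + b / mu ^+ 2) - b / b1 / (mu / mu1) ^+ 2 * (a1 * c + b1 / mu1 ^+ 2).
    by field; rewrite mun0 mu1n0 b1n0.
  by rewrite tE tE1 mulr0 subrr.
split => //; apply/funext => x; rewrite /rescale /= enormZ (gtr0_norm l0) /profile.
have -> : (mu / mu1 * enorm x <= rad1) = (enorm x <= rad).
  by rewrite -ler_pdivlMl// -radE.
case: ifP => _; last by rewrite mulr0.
have -> : mu1 * (mu / mu1 * enorm x) = mu * enorm x by rewrite mulrA mulrCA mulfV ?mulr1.
by rewrite {1}aE; field; rewrite mun0 mu1n0 b1n0.
Qed.

Lemma minimizer_parameters_scaling (b a a1 mu mu1 rad rad1 : R) :
  0 < b -> minimizer_parameters b a mu rad -> minimizer_parameters 1 a1 mu1 rad1 ->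
  [/\ a = b `^ (3 / 7) * a1, mu = b `^ (2 / 7) * mu1, rad = b `^ (- (2 / 7)) * rad1 &
   (Fmin b = (b `^ (4 / 7))%:E * Fmin 1)%E].
Proof.
move=> b0 P P1; have [l0 aE radE pE] := profile_rescale b0 ltr01 P P1.
have [_ _ _ _ [m _]] := P; have [_ mu10 _ _ [m1 _]] := P1.
have [adm _] := m; have [adm1 _] := m1.
have [_ _ N] := adm; have [H _ N1] := adm1.
move: aE radE pE; rewrite divr1; set l := mu / mu1 in l0 *.
set s := b / l ^+ 2; set phi1 := _ \o enorm in m1 adm1 H N1 * => aE radE pE.
have s0 : 0 < s by rewrite divr_gt0// exprn_gt0.
have ln0 : l != 0 by rewrite gt_eqF.
have two0 : (2 : R) != 0 by rewrite pnatr_eq0.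
have mphi1 : measurable_fun setT phi1 by have [/measurable_Lfun2] := H.
(* Both minimizers have L^2 norm 1. *)
have sl : s ^+ 2 = l ^+ 3.
  have := @Lnorm_rescale R 2 s l phi1 two0 l0 mphi1.
  rewrite -pE N N1 poweR1r mule1 => -[] /esym.
  rewrite (gtr0_norm s0) powR_mulrn ?ltW// => /(congr1 (fun x => x * l ^+ 3)).
  by rewrite mul1r mulfVK// expf_neq0.
have [lE sE l2E] := scale_exponents b0 l0 erefl sl.
split.
- by rewrite aE -sE.
- by rewrite -lE /l mulfVK// gt_eqF.
- by rewrite powRN -lE.
rewrite (Fmin_minimizer m) (Fmin_minimizer m1) pE.
have bE : b = 1 * (s * l ^+ 2) by rewrite mul1r mulfVK// expf_neq0.
by rewrite {1}bE energy_rescale ?ltW// l2E.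
Qed.

End ScalingLaws.

Theorem proposition11 (R : realType) (a mu rad : R -> R)
  (hparam : forall beta : R, 0 < beta ->
     minimizer_parameters beta (a beta) (mu beta) (rad beta)) :
  (exists a1 mu1 rad1 : R, [/\ 0 < a1, 0 < mu1, 0 < rad1 &
     forall beta : R, 0 < beta ->
       [/\ a beta = beta `^ (3 / 7) * a1,
           mu beta = beta `^ (2 / 7) * mu1 &
           rad beta = beta `^ (- (2 / 7)) * rad1]]) /\
  (exists2 F1 : R, 0 < F1 &
     forall beta : R, 0 < beta -> Fmin beta = (beta `^ (4 / 7) * F1)%:E).
Proof.
have P1 := hparam 1 ltr01; have [a0 mu0 [rad0 _ _] _ [m1 _]] := P1.
split.
  exists (a 1), (mu 1), (rad 1); split => // b b0.
  by have [] := minimizer_parameters_scaling b0 (hparam b b0) P1.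
have [adm1 _] := m1; have [F F0 FE] := energy_fin_pos ltr01 adm1.
exists F => // b b0.
have [_ _ _ ->] := minimizer_parameters_scaling b0 (hparam b b0) P1.
by rewrite (Fmin_minimizer m1) FE.
Qed.
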